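(* Let $G$ be a finite solvable group. Then the following statements are equivalent: (1) $G$ is an SST-group. (2) $G$ is an NSST-group. (3) Every subgroup of $G$ is SS-permutable in $G$. (4) Every subgroup of $G$ is NSS-permutable in $G$. (5) Every subgroup of $G$ of prime power order is SS-permutable in $G$. (6) Every subgroup of $G$ of prime power order is NSS-permutable in $G$. (7) Every cyclic subgroup of $G$ of prime power order is SS-permutable in $G$. (8) Every cyclic subgroup of $G$ of prime power order is NSS-permutable in $G$.
   Context: All groups are finite. Two subgroups $A,B$ of a group permute if $AB=BA$. A supplement of $H$ in $G$ is a subgroup $K\le G$ with $G=HK$. A subgroup $H$ of a group $G$ is SS-permutable in $G$ if $H$ has a supplement $K$ in $G$ such that $H$ permutes with every Sylow subgroup of $K$ (for all primes). $H$ is NSS-permutable in $G$ if $H$ has such a supplement $K$ which is moreover normal in $G$. $G$ is an SST-group (resp. NSST-group) if SS-permutability (resp. NSS-permutability) is a transitive relation on its subgroups: whenever $H\le K\le G$, $H$ is SS-permutable (resp. NSS-permutable) in $K$ and $K$ is SS-permutable (resp. NSS-permutable) in $G$, then $H$ is SS-permutable (resp. NSS-permutable) in $G$. *)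

(* Defs.v *)
From mathcomp Require Import all_boot all_fingroup all_solvable.

Set Implicit Arguments.
Unset Strict Implicit.
Unset Printing Implicit Defensive.

Local Open Scope group_scope.

Section SSPermutability.

Variable gT : finGroupType.
Implicit Types G H K P : {group gT}.

Definition permutes_with_Sylows H K : Prop :=
  forall (p : nat) P, prime p -> P \in 'Syl_p(K) -> H * P = P * H.

Definition SS_permutable H G : Prop :=
  H \subset G /\
  exists K, [/\ K \subset G, H * K = G & permutes_with_Sylows H K].

Definition NSS_permutable H G : Prop :=
  H \subset G /\
  exists K, [/\ K <| G, H * K = G & permutes_with_Sylows H K].

Definition SST_group G : Prop :=
  forall H K, H \subset K -> K \subset G ->
    SS_permutable H K -> SS_permutable K G -> SS_permutable H G.

Definition NSST_group G : Prop :=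
  forall H K, H \subset K -> K \subset G ->
    NSS_permutable H K -> NSS_permutable K G -> NSS_permutable H G.

End SSPermutability.

(* Main.v *)
Require Import Defs.
From mathcomp Require Import all_boot all_fingroup all_solvable.
Set Implicit Arguments.
Unset Strict Implicit.
Unset Printing Implicit Defensive.
Local Open Scope group_scope.

(** Everything is deduced from the weakest condition: every cyclic subgroup of
    prime power order is SS-permutable in G. It implies that every subgroup is
    NSS-permutable, and when all subgroups are (N)SS-permutable the relation is
    trivially transitive. What remains is to get from transitivity to
    subgroups of prime power order.

    An SS-permutable p-subgroup permutes with the Sylow q-subgroups of G for
    all q <> p ([SS_permutable_pgroup_Sylow]). If this is known for the
    cyclic subgroups of the minimal normal subgroups of all quotients of G,
    those minimal normal subgroups are cyclic, and G' is nilpotent, that is,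
    G' <= F(G) ([der1_nil_minnormal]). Both transitivity and the cyclic
    condition provide this hypothesis.

    If the relation is transitive, let H <= P with P a Sylow p-subgroup of G.
    Then H is permutable in the p-group P, P is permutable in P F(G) (supplement
    O_p'(F(G))), and P F(G) is normal in G since it contains G'. So H is
    permutable in G ([transitive_pgroup]).

    Suppose now the cyclic condition. Let V = O_p'(F(G)). Each p-element
    x of P normalises every cyclic q-subgroup of V, so that if x moves some
    element of V, it moves some element of prime order q of Z(V) and it fixes
    no element of order q of Z(V) ([moved_prime_center]). Let K be a supplement
    witnessing that <x> is SS-permutable and put K0 = P :&: K, so that
    P = <x> K0. For a in Z(V), <x> and K0 ^ a generate a p-group, hence lie in
    a common conjugate of P by an element of Z(V); this gives
    Z(V) = C(K0) C(x) inside Z(V), so K0 fixes each element of prime order of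
    Z(V) that x moves ([pelt_supplement]). Combining this for x, for an element
    y of K0 and for x y shows that K0 centralises V, so P = <x> C_P(V) for
    each x in P outside C(V) ([supplement_cent_p'core]). As C_P(V) <= O_p(G),
    P = <x> O_p(G) for each x in P outside O_p(G) ([Sylow_sub_cycle_pcore]).

    Finally, given H <= G, let pi be the set of primes p such that all
    p-elements of H are in O_p(G), and K / F(G) = O_pi(G / F(G)). Then K is a
    normal supplement of H. For p in pi, the Sylow p-subgroups of K are Sylow
    in G and contain the p-elements of H; for the other primes O_p(G) is
    the Sylow p-subgroup of K. In both cases H permutes with them
    ([cyclic_NSS_permutable]). *)

(** * SS-permutable subgroups: Sylow subgroups, quotients, supplements *)

Section Permutability.
Variable gT : finGroupType.
Implicit Types G H K M N P Q V : {group gT}.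

(** A group is generated by its elements of prime power order. *)
Lemma subset_pelt (G H : {group gT}) :
  (forall (p : nat) x, prime p -> x \in G -> p.-elt x -> x \in H) ->
  G \subset H.
Proof.
move=> sGH; apply/subsetP=> x Gx; rewrite -(prod_constt x).
apply: group_prod => p _; have [p_pr | p'p] := boolP (prime p).
  by apply: (sGH p); rewrite ?p_elt_constt ?groupX.
suff -> : x.`_p = 1 by apply: group1.
by apply/eqP; rewrite -order_eq1 order_constt p_part lognE (negPf p'p).
Qed.

Lemma NSS_permutable_SS H G : NSS_permutable H G -> SS_permutable H G.
Proof.
case=> sHG [K [nKG defG pK]]; split=> //; exists K; split=> //.
exact: normal_sub.
Qed.

Lemma mulg_groupC H K G : H * K = G -> K * H = G.
Proof.
move=> defG; rewrite -defG; apply/esym.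
by suffices: commute H K by []; apply/comm_group_setP; rewrite defG groupP.
Qed.

Lemma index_supplement H K G : H * K = G -> #|G : K| = #|H : K|.
Proof. by move/mulg_groupC <-; rewrite indexMg. Qed.

Lemma SS_permutable_pgroup_Sylow (p q : nat) H G Q :
    p.-group H -> SS_permutable H G -> prime q -> q.-Sylow(G) Q -> q != p ->
  H * Q = Q * H.
Proof.
move=> pH [sHG [K [sKG defG permHK]]] q_pr sylQ neq_qp.
have [Q0 sylQ0] := Sylow_exists q K.
(* The index of K is a power of p, so the Sylow q-subgroups of K are Sylow
   in G; the other ones are conjugates of these by elements of H. *)
have pG_K : p.-nat #|G : K|.
  by rewrite (index_supplement defG) -indexgI (pnat_dvd (dvdn_indexg _ _)).
have sylGQ0 : q.-Sylow(G) Q0.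
  rewrite pHallE (subset_trans (pHall_sub sylQ0) sKG) /=.
  rewrite (card_Hall sylQ0) -(Lagrange sKG) partnM ?cardG_gt0 //.
  rewrite [X in (_ * X)%N]part_p'nat ?muln1 //.
  by apply: sub_in_pnat pG_K => r _ /eqnP->; rewrite !inE eq_sym.
have [g Gg ->] := Sylow_trans sylGQ0 sylQ.
have : g \in K * H by rewrite (mulg_groupC defG).
case/mulsgP=> k h Kk Hh ->; rewrite conjsgM.
have sylK : (Q0 :^ k)%G \in 'Syl_q(K) by rewrite inE pHallJ.
have := permHK q _ q_pr sylK.
by move/(congr1 (conjugate^~ h)); rewrite !conjsMg (conjGid Hh).
Qed.

Lemma permutable_sub_norm (A P V : {group gT}) :
    A \subset V -> P \subset 'N(V) -> P :&: V = 1 -> A * P = P * A ->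
  P \subset 'N(A).
Proof.
move=> sAV nVP tiPV cAP.
(* A is the intersection of V with the group A * P. *)
have defA: (A <*> P) :&: V = A :> {set gT}.
  by rewrite (comm_joingE cAP) -group_modl // tiPV mulg1.
rewrite -defA normsI // (subset_trans (joing_subr A P)) ?normG //.
Qed.

Lemma SS_permutable_quotient N H G :
  N <| G -> SS_permutable H G -> SS_permutable (H / N)%G (G / N)%G.
Proof.
move=> /andP[_ nNG] [sHG [K [sKG defG permHK]]]; split; first exact: quotientS.
have nNH := subset_trans sHG nNG; have nNK := subset_trans sKG nNG.
exists (K / N)%G; split; rewrite /= ?quotientS -?quotientMl ?defG //.
move=> p Pb p_pr; rewrite inE => sylPb.
have [P sylP] := Sylow_exists p K.
have nNP := subset_trans (pHall_sub sylP) nNK.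
have [xb Kxb defPb] := Sylow_trans (quotient_pHall nNP sylP) sylPb.
case/morphimP: Kxb defPb => x nNx Kx -> ->.
rewrite -quotientJ // -!quotientMl //; last first.
  by rewrite (subset_trans _ nNK) ?conj_subG ?(pHall_sub sylP).
congr (_ / N); apply: (permHK p (P :^ x)%G) => //.
by rewrite inE pHallJ.
Qed.

(** An element of order p of M that is central in a Sylow p-subgroup generates a
    subgroup normalised by a Sylow q-subgroup of G for each prime q, hence a
    normal one. *)
Lemma minnormal_cyclic M G :
    solvable G -> minnormal M G -> M \subset G ->
    (forall x, x \in M -> SS_permutable <[x]>%G G) ->
  exists x, M :=: <[x]>.
Proof.
move=> solG minM sMG permM.
have [nMG ntM /is_abelemP[p p_pr abelM]] := minnormal_solvable minM sMG solG.
have pM := abelem_pgroup abelM.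
have nsMG : M <| G by apply/andP.
have [P sylP] := Sylow_exists p G.
have sMP : M \subset P.
  by rewrite (subset_trans (pcore_max pM nsMG)) ?pcore_sub_Hall.
have nsMP : M <| P by rewrite (normalS _ (pHall_sub sylP)).
have := meet_center_nil (pgroup_nil (pHall_pgroup sylP)) nsMP ntM.
case/trivgPn=> x /setIP[Mx /setIP[Px cPx]] ntx; exists x.
have pX : p.-group <[x]> by rewrite (pgroupS _ pM) ?cycle_subG.
have nxG : G \subset 'N(<[x]>).
  pose T := [set Q : {group gT} | Q \subset 'N_G(<[x]>)].
  have defG : <<\bigcup_(Q in T) Q>> = G.
    apply: Sylow_transversal_gen => [Q | q].
      by rewrite inE subsetI => /andP[].
    rewrite mem_primes => /and3P[q_pr _ _].
    have [-> | neq_qp] := eqVneq q p.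
      exists P; rewrite // inE subsetI (pHall_sub sylP) /= cents_norm //.
      by rewrite centsC cycle_subG.
    have [Q sylQ] := Sylow_exists q G.
    exists Q; rewrite // inE subsetI (pHall_sub sylQ) /=.
    have nMQ := subset_trans (pHall_sub sylQ) nMG.
    apply: (@permutable_sub_norm _ Q M); rewrite ?cycle_subG //.
      apply: coprime_TIg; rewrite coprime_sym (pnat_coprime pM) //.
      apply: sub_in_pnat (pHall_pgroup sylQ) => r _ /eqnP->.
      by rewrite !inE.
    exact: SS_permutable_pgroup_Sylow pX (permM x Mx) q_pr sylQ neq_qp.
  rewrite -{1}defG gen_subG; apply/bigcupsP=> Q.
  by rewrite inE subsetI => /andP[].
case/mingroupP: minM => _ minM; apply/esym.
by apply: minM; rewrite ?cycle_subG // cycle_eq1 ntx.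
Qed.

Lemma der1_cent_cyclic G x : G \subset 'N(<[x]>) -> G^`(1) \subset 'C(<[x]>).
Proof.
move=> nxG; rewrite gen_subG; apply/subsetP=> _ /imset2P[y z Gy Gz ->].
have xJ g : g \in G -> exists i, x ^ g^-1 = x ^+ i.
  move=> Gg; apply/cycleP.
  by rewrite memJ_norm ?cycle_id // groupV (subsetP nxG).
have [[i xy] [j xz]] := (xJ y Gy, xJ z Gz).
rewrite /= cent_cycle; apply/cent1P/esym/commgP/conjg_fixP.
(* The automorphisms of a cyclic group commute. *)
have -> : [~ y, z] = y^-1 * z^-1 * (z^-1 * y^-1)^-1.
  by rewrite invMg !invgK /commg /conjg !mulgA.
have eqx : x ^ (y^-1 * z^-1) = x ^ (z^-1 * y^-1).
  by rewrite !conjgM xy xz !conjXg xy xz -!expgM mulnC.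
by rewrite conjgM eqx -conjgM mulgV conjg1.
Qed.

Lemma NSS_permutable_normal H G : H <| G -> NSS_permutable H G.
Proof.
case/andP=> sHG nHG; split=> //; exists G; split; rewrite ?mulSGid // => p P _.
rewrite inE => sylP; apply: esym; apply: normC.
exact: subset_trans (pHall_sub sylP) nHG.
Qed.

Lemma NSS_permutable_pgroup (p : nat) H P :
  p.-group P -> H \subset P -> NSS_permutable H P.
Proof.
move=> pP sHP; split=> //; exists P; split; rewrite ?mulSGid // => q Q _.
rewrite inE => sylQ; have sQP := pHall_sub sylQ.
have [eq_qp | neq_qp] := eqVneq q p.
  have -> : Q :=: P by apply/esym/(sub_pHall sylQ); rewrite ?eq_qp.
  by rewrite mulSGid // mulGSid.
suff -> : Q :=: 1 by rewrite mulg1 mul1g.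
apply: card1_trivg; apply: (@pnat_1 p); first exact: pgroupS sQP pP.
by apply: sub_in_pnat (pHall_pgroup sylQ) => r _ /eqnP->; rewrite !inE.
Qed.

Lemma NSS_permutable_nil_supplement P V G :
  P \subset G -> V <| G -> nilpotent V -> P * V = G -> NSS_permutable P G.
Proof.
move=> sPG nsVG nilV defG; split=> //; exists V; split=> // q Q _.
rewrite inE => /(nilpotent_Hall_pcore nilV)->; apply: normC.
exact: subset_trans sPG (gFnorm_trans _ (normal_norm nsVG)).
Qed.

End Permutability.

(** * Nilpotency of the derived subgroup *)

Section DerivedSubgroup.

Variable gT : finGroupType.
Implicit Types G M N : {group gT}.

(** Minimal normal subgroups of quotients of G are cyclic, so their
    automorphism groups are abelian and G' centralises all chief factors;
    the lower central series of G' goes down to 1 along a chief series. *)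
Lemma der1_nil_minnormal G :
    solvable G ->
    (forall N (M : {group coset_of N}), N <| G -> minnormal M (G / N) ->
       M \subset G / N ->
       forall x, x \in M -> SS_permutable <[x]>%G (G / N)%G) ->
  nilpotent G^`(1).
Proof.
move=> solG permG.
suffices lcnN k N : N <| G -> #|G : N| <= k ->
    exists n, 'L_n.+1(G^`(1)) \subset N.
  have [n] := lcnN _ 1%G (normal1 G) (leqnn _).
  by move/trivgP=> Ln1; apply/lcnP; exists n.
elim: k => [|k IHk] in N * => nsNG; first by rewrite leqNgt indexg_gt0.
move=> le_GN_k; have [sNG nNG] := andP nsNG.
have [GN1 | ntGN] := eqVneq (G / N) 1.
  exists 0; apply: subset_trans (der_sub 1 G) _.
  by rewrite -quotient_sub1 // GN1.
have [Mb minMb sMbG] := minnormal_exists ntGN (normG _).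
have [xb defMb] :=
  minnormal_cyclic (quotient_sol N solG) minMb sMbG
                   (permG N Mb nsNG minMb sMbG).
have [/andP[ntMb nMbG] _] := mingroupP minMb.
have nsMbG : Mb <| G / N by apply/andP.
have [M defM sNM nsMG] := inv_quotientN nsNG nsMbG.
(* M / N is a chief factor: the next term of the lower central series after
   one contained in M is contained in N. *)
have [|n sLM] := IHk M nsMG.
  rewrite -ltnS (leq_trans _ le_GN_k) //.
  rewrite -(Lagrange_index (normal_sub nsMG) sNM).
  rewrite ltn_Pmulr ?indexg_gt0 // indexg_gt1.
  apply: contraNN ntMb => sMN; apply/eqP/trivgP.
  by rewrite defM quotient_sub1 // (subset_trans (normal_sub nsMG)).
exists n.+1; rewrite lcnSn; apply: subset_trans (commSg _ sLM) _.
rewrite -quotient_cents2 ?(subset_trans (normal_sub nsMG))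
        ?(subset_trans (der_sub 1 G)) //.
rewrite -defM centsC quotient_der // defMb.
by apply: der1_cent_cyclic; rewrite -defMb.
Qed.

End DerivedSubgroup.

(** * Transitivity of permutability *)

(** SS-permutability and NSS-permutability are treated together: R is any
    relation between the two that is transitive below G. *)
Section Transitive.

Variable gT : finGroupType.
Implicit Types H K : {group gT}.

Variables (G : {group gT}) (R : {group gT} -> {group gT} -> Prop).
Hypothesis solG : solvable G.
Hypothesis NSS_R : forall H K, NSS_permutable H K -> R H K.
Hypothesis R_SS : forall H K, R H K -> SS_permutable H K.
Hypothesis R_trans :
  forall H K, H \subset K -> K \subset G -> R H K -> R K G -> R H G.

Lemma transitive_der1_nil : nilpotent G^`(1).
Proof.
apply: der1_nil_minnormal => // N Mb nsNG minMb sMbG x Mx.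
have [nMbG _ /is_abelemP[p _ abelM]] :=
  minnormal_solvable minMb sMbG (quotient_sol N solG).
have nsMbG : Mb <| G / N by apply/andP.
have [M defM sNM nsMG] := inv_quotientN nsNG nsMbG.
have nsXM : <[x]> <| M / N.
  have sxM : <[x]> \subset Mb by rewrite cycle_subG.
  by rewrite -defM -sub_abelian_normal // (abelem_abelian abelM).
have nsNM : N <| M by rewrite (normalS sNM (normal_sub nsMG)).
(* The preimage X of <[x]> is normal in M, which is normal in G. *)
have [X defX sNX nsXM'] := inv_quotientN nsNM nsXM.
have sMG := normal_sub nsMG; have sXM := normal_sub nsXM'.
have XG : SS_permutable X G.
  by apply/R_SS/(R_trans sXM sMG); apply: NSS_R; apply: NSS_permutable_normal.
suff -> : <[x]>%G = (X / N)%G by apply: SS_permutable_quotient.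
exact: group_inj.
Qed.

Lemma transitive_pgroup H : H \subset G -> p_group H -> R H G.
Proof.
move=> sHG /p_groupP[p _ pH].
have [P sylP sHP] := Sylow_superset sHG pH.
have sPG := pHall_sub sylP; have pP := pHall_pgroup sylP.
have nsFG := Fitting_normal G; have [sFG nFG] := andP nsFG.
have nFP := subset_trans sPG nFG.
have sG'F : G^`(1) \subset 'F(G) :=
  Fitting_max (der_normal 1 G) transitive_der1_nil.
have nsPFG : P <*> 'F(G) <| G.
  by rewrite sub_der1_normal ?(subset_trans sG'F) ?joing_subr // join_subG sPG.
have sPPF := joing_subl P 'F(G).
apply: (R_trans sHP sPG); first exact: NSS_R (NSS_permutable_pgroup pP sHP).
apply: (R_trans sPPF (normal_sub nsPFG)); last first.
  exact: NSS_R (NSS_permutable_normal nsPFG).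
apply: NSS_R; apply: (@NSS_permutable_nil_supplement _ _ 'O_p^'('F(G))%G) => //.
- by rewrite gFnormal_trans // (normalS (joing_subr _ _) (normal_sub nsPFG)).
- exact: nilpotentS (pcore_sub _ _) (Fitting_nil G).
have sOP : 'O_p('F(G)) \subset P.
  by rewrite p_core_Fitting pcore_sub_Hall.
have /dprodP[_ defF _ _] := nilpotent_pcoreC p (Fitting_nil G).
by rewrite /= norm_joinEl // -[in RHS]defF mulgA (mulGSid sOP).
Qed.

End Transitive.

(** * Fixed points of elements acting on cyclic groups *)

Section FixedPoints.

Variable gT : finGroupType.
Implicit Types a b c u v x : gT.

(** If x stabilises <[a]> and <[a * b]> and fixes b, it acts as a scalar on the
    elementary abelian q-group generated by a and b, and this scalar is 1. *)
Lemma conj_fix_mul_norm (q : nat) (a b x : gT) :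
    prime q -> #[a] = q -> #[b] = q -> commute a b ->
    x \in 'N(<[a]>) -> x \in 'N(<[a * b]>) -> b ^ x = b ->
  a ^ x = a.
Proof.
move=> q_pr oa ob cab nax nabx bx.
have /cycleP[i ax] : a ^ x \in <[a]> by rewrite memJ_norm ?cycle_id.
have /cycleP[j abx] : (a * b) ^ x \in <[a * b]> by rewrite memJ_norm ?cycle_id.
have [a_b | a'b] := boolP (<[a]> \subset <[b]>).
  have /cycleP[k ->] : a \in <[b]> by rewrite -cycle_subG.
  by rewrite conjXg bx.
have tiab : <[a]> :&: <[b]> = 1 by rewrite prime_TIg // -orderE oa.
move: abx; rewrite conjMg bx ax expgMn // => abx.
have eqij : (a ^+ j)^-1 * a ^+ i = b ^+ j * b^-1.
  by apply: (mulIg b); rewrite -mulgA mulgKV abx mulKg.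
have : (a ^+ j)^-1 * a ^+ i \in <[a]> :&: <[b]>.
  rewrite inE {2}eqij !groupM ?groupV ?mem_cycle ?cycle_id //.
rewrite tiab => /set1gP eij.
have : b ^+ j == b ^+ 1 by rewrite expg1 eq_mulgV1 -eqij eij.
rewrite eq_expg_mod_order ob -oa -eq_expg_mod_order expg1 => /eqP aj.
by move/eqP: eij; rewrite -eq_mulVg1 aj => /eqP <-.
Qed.

(** A q'-element acting nontrivially on a cyclic q-group moves its elements of
    order q. *)
Lemma coprime_cent_cycle_prime (q : nat) (a x : gT) :
    q.-elt a -> q^'.-elt x -> x \in 'N(<[a]>) ->
    (forall c, c \in <[a]> -> #[c] = q -> c ^ x = c) -> a ^ x = a.
Proof.
move=> qa q'x nax fixx; apply/conjg_fixP/commgP.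
apply/cent1P; rewrite -cent_cycle -sub1set.
have nAX : <[x]> \subset 'N(<[a]>) by rewrite cycle_subG.
have co : coprime #|<[a]>| #|<[x]>| by apply: pnat_coprime qa q'x.
have tiC := coprime_abel_cent_TI nAX co (cycle_abelian a).
have [R1 | ntR] := eqVneq [~: <[a]>, <[x]>] 1.
  by move/commG1P: R1; rewrite sub1set => /subsetP-> //; rewrite cycle_id.
have sRa : [~: <[a]>, <[x]>] \subset <[a]> by rewrite commg_subl.
have qR : q.-group [~: <[a]>, <[x]>] by apply: pgroupS sRa _.
have [q_pr q_dv _] := pgroup_pdiv qR ntR.
have [c Rc oc] := Cauchy q_pr q_dv.
have : c \in 'C_[~: <[a]>, <[x]>](<[x]>).
  rewrite inE Rc cent_cycle; apply/cent1P/commgP/conjg_fixP.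
  by rewrite fixx ?(subsetP sRa).
by rewrite tiC => /set1gP c1; rewrite c1 order1 in oc; rewrite -oc in q_pr.
Qed.

Lemma conjg_fix_expg (p n : nat) (a x : gT) :
  prime p -> p.-elt x -> ~~ (p %| n) -> a ^ (x ^+ n) = a -> a ^ x = a.
Proof.
move=> p_pr /p_natP[k ox] p'n fixa.
have co : coprime #[x] n by rewrite ox coprimeXl // prime_coprime.
apply/conjg_fixP/commgP/cent1P; rewrite -cent_cycle -cycle_subG centsC.
move: co; rewrite -generator_coprime => /eqP->.
by rewrite cycle_subG /= cent_cycle; apply/cent1P/commute_sym/commgP/conjg_fixP.
Qed.

Lemma conjg_expg_eq (a u v : gT) n :
  u \in 'N(<[a]>) -> a ^ u = a ^ v -> a ^ (u ^+ n) = a ^ (v ^+ n).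
Proof.
move=> nau equv.
have /cycleP[m au] : a ^ u \in <[a]> by rewrite memJ_norm ?cycle_id.
have av : a ^ v = a ^+ m by rewrite -equv.
elim: n => [|n IHn]; first by rewrite !expg0.
by rewrite !expgS !conjgM au av !conjXg IHn.
Qed.

End FixedPoints.

(** * Groups whose cyclic primary subgroups are SS-permutable *)

Section CyclicPermutable.

Variable gT : finGroupType.
Implicit Types H K P Q : {group gT}.

(** The elements h of H with h P contained in P H form a group, which contains
    the elements of prime power order of H. *)
Lemma pelt_permute_permute H P :
    (forall (q : nat) x, prime q -> x \in H -> q.-elt x ->
       <[x]> * P = P * <[x]>) ->
  H * P = P * H.
Proof.
move=> permH.
have gsT : group_set [set h in H | h *: P \subset P * H].
  apply/group_setP; split=> [|x y]; rewrite !inE.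
    by rewrite group1 lcoset1 mulG_subl.
  case/andP=> Hx sxP /andP[Hy syP]; rewrite groupM //= lcosetM.
  apply: subset_trans (_ : x *: (P * H) \subset _); first by rewrite mulgS.
  by rewrite mulgA -{2}(mulGid H) mulgA mulSg.
have sHT : H \subset Group gsT.
  apply: subset_pelt => q x q_pr Hx qx; rewrite inE Hx /=.
  apply: subset_trans (_ : P * <[x]> \subset _); last first.
    by rewrite mulgS // cycle_subG.
  by rewrite -(permH q) // mulSg // sub1set cycle_id.
apply/eqP; rewrite eqEcard -(card_invg (H * P)) invMg !invGid leqnn andbT.
apply/subsetP=> _ /mulsgP[h y Hh Py ->].
have := subsetP sHT h Hh; rewrite inE => /andP[_ /subsetP]; apply.
by rewrite mem_lcoset mulKg.
Qed.

Variable G : {group gT}.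
Hypothesis solG : solvable G.
Hypothesis permG : forall H : {group gT},
  H \subset G -> cyclic H -> p_group H -> SS_permutable H G.

Lemma SS_permutable_pelt (p : nat) x :
  x \in G -> p.-elt x -> SS_permutable <[x]>%G G.
Proof.
move=> Gx px; apply: permG; rewrite ?cycle_subG ?cycle_cyclic //.
exact: pgroup_p px.
Qed.

Lemma pelt_permutes_Sylow (p q : nat) x Q :
    x \in G -> p.-elt x -> prime q -> q.-Sylow(G) Q -> q != p ->
  <[x]> * Q = Q * <[x]>.
Proof.
move=> Gx px q_pr sylQ neq_qp.
exact: SS_permutable_pgroup_Sylow (SS_permutable_pelt Gx px) q_pr sylQ neq_qp.
Qed.

Lemma cyclic_der1_nil : nilpotent G^`(1).
Proof.
apply: der1_nil_minnormal => // N Mb nsNG minMb sMbG x Mx.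
have [_ _ /is_abelemP[p _ abelM]] :=
  minnormal_solvable minMb sMbG (quotient_sol N solG).
have px : p.-elt x := mem_p_elt (abelem_pgroup abelM) Mx.
have /morphimP[y nNy Gy defx] : x \in G / N := subsetP sMbG x Mx.
have -> : <[x]>%G = (<[y.`_p]> / N)%G.
  apply: group_inj; rewrite /= quotient_cycle ?groupX //.
  by rewrite morph_constt //= (_ : coset N y = x) ?constt_p_elt.
apply: SS_permutable_quotient => //.
by apply: (@SS_permutable_pelt p); rewrite ?groupX ?p_elt_constt.
Qed.

Lemma sub_der1_Fitting : G^`(1) \subset 'F(G).
Proof. exact: Fitting_max (der_normal 1 G) cyclic_der1_nil. Qed.

Section OnePrime.

Variables (p : nat) (P : {group gT}).
Hypotheses (p_pr : prime p) (sylP : p.-Sylow(G) P).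

Let V := 'O_p^'('F(G)).

Let sPG : P \subset G. Proof. exact: pHall_sub sylP. Qed.
Let pP : p.-group P. Proof. exact: pHall_pgroup sylP. Qed.
Let nsVG : V <| G.
Proof. exact: gFnormal_trans (Fitting_normal G). Qed.
Let p'V : p^'.-group V. Proof. exact: pcore_pgroup. Qed.
Let nilV : nilpotent V.
Proof. exact: nilpotentS (pcore_sub _ _) (Fitting_nil G). Qed.
Let tiPV : P :&: V = 1.
Proof. by apply: coprime_TIg; apply: pnat_coprime pP p'V. Qed.
Let nVP : P \subset 'N(V).
Proof. exact: subset_trans sPG (normal_norm nsVG). Qed.

Lemma norm_cycle_p'core (q : nat) a :
  prime q -> q.-elt a -> a \in V -> P \subset 'N(<[a]>).
Proof.
move=> q_pr qa Va; have [eq_qp | neq_qp] := eqVneq p q.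
  have /eqP-> : a == 1.
    rewrite -order_eq1; apply/eqP; apply: (@pnat_1 p); first by rewrite eq_qp.
    exact: mem_p_elt p'V Va.
  by rewrite cycle1 norms1.
apply: permutable_sub_norm nVP tiPV _; first by rewrite cycle_subG.
apply: pelt_permutes_Sylow qa p_pr sylP neq_qp.
exact: subsetP (normal_sub nsVG) a Va.
Qed.

(** If x moves a q-element a of V, it moves a power of a of order q, hence also
    every element of order q of Z(V), and there are such elements. *)
Lemma moved_prime_center x :
    x \in P -> x \notin 'C(V) ->
  exists2 a, a \in 'Z(V) & prime #[a] /\ a ^ x != a.
Proof.
move=> Px not_cVx.
have [/exists_inP[a Za /andP[a_pr xa]] | noa] :=
  boolP [exists a in 'Z(V), prime #[a] && (a ^ x != a)]; first by exists a.
case/negP: not_cVx; rewrite -sub1set centsC cent_set1.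
have fixZ z : z \in 'Z(V) -> prime #[z] -> z ^ x = z.
  move=> Zz z_pr; apply/eqP; apply: contraNT noa => xz.
  by apply/exists_inP; exists z; rewrite ?z_pr.
apply: (@subset_pelt _ V 'C[x]%G) => q a q_pr Va qa.
suff : a ^ x = a by move/conjg_fixP/commgP/cent1P.
have [-> | nta] := eqVneq a 1; first exact: conj1g.
have [sZV cVZ] := subsetIP (subxx 'Z(V)).
have q_dv : q %| #|V|.
  apply: dvdn_trans (order_dvdG Va).
  by have [|_ ] := pgroup_pdiv qa; rewrite ?cycle_eq1.
have neq_qp : q != p by move/pgroupP: p'V => /(_ q q_pr q_dv); rewrite !inE.
have xN b : b \in V -> q.-elt b -> x \in 'N(<[b]>).
  by move=> Vb qb; apply: (subsetP (norm_cycle_p'core q_pr qb Vb)).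
apply: (coprime_cent_cycle_prime qa _ (xN a Va qa)).
  apply: sub_p_elt (mem_p_elt pP Px) => r.
  by rewrite !inE => /eqP->; rewrite eq_sym.
move=> c a_c oc.
have Vc : c \in V by apply: subsetP a_c; rewrite cycle_subG.
have q_dvZ : q %| #|'Z(V)|.
  have : q \in \pi('Z(V)).
    by rewrite pi_center_nilpotent // mem_primes q_pr cardG_gt0.
  by rewrite mem_primes => /and3P[].
have [z Zz oz] := Cauchy q_pr q_dvZ.
have ccz : commute c z by apply/esym/(centP (subsetP cVZ z Zz)).
have qelt d : d ^+ q = 1 -> q.-elt d.
  move=> dq1; apply: pnat_dvd (pnat_id q_pr).
  by rewrite order_dvdn dq1.
have qc : q.-elt c by rewrite /p_elt oc pnat_id.
apply: (conj_fix_mul_norm q_pr oc oz ccz (xN c Vc qc)).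
  apply: xN; first by rewrite groupM // (subsetP sZV).
  by apply: qelt; rewrite expgMn // -{1}oc -oz !expg_order mulg1.
by apply: fixZ; rewrite ?oz.
Qed.

(** Here K0 is the intersection of P with a supplement K of <[x]> such that
    <[x]> permutes with the Sylow subgroups of K. *)
Lemma pelt_supplement x :
    x \in P ->
  exists K0 : {group gT}, <[x]> * K0 = P /\
    (forall a, a \in 'Z(V) -> prime #[a] -> a ^ x != a ->
     forall y, y \in K0 -> a ^ y = a).
Proof.
move=> Px; have Gx : x \in G := subsetP sPG x Px.
have px : p.-elt x := mem_p_elt pP Px.
have sxP : <[x]> \subset P by rewrite cycle_subG.
have [_ [K [sKG defG permK]]] := SS_permutable_pelt Gx px.
have defP : <[x]> * (K :&: P) = P.
  by rewrite group_modl // defG (setIidPr sPG).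
have sylK0 : p.-Sylow(K) (K :&: P).
  rewrite /pHall subsetIl (pgroupS (subsetIr _ _) pP) indexgI -indexMg.
  suff -> : P * K = G by case/and3P: sylP.
  apply/eqP; rewrite eqEsubset mul_subG //= -{1}defG mulSg //.
(* K has index a power of p, so it contains the normal p'-subgroup V. *)
have sVK : V \subset K.
  rewrite -indexg_eq1; apply/eqP; apply: (@pnat_1 p).
    rewrite -indexMg -norm_joinEl ?(subset_trans sKG) ?(normal_norm nsVG) //.
    have sKVG : K <*> V \subset G by rewrite join_subG sKG normal_sub.
    apply: pnat_dvd (indexSg (joing_subl K V) sKVG) _.
    by rewrite (index_supplement defG) -indexgI (pnat_dvd (dvdn_indexg _ _)).
  by rewrite -indexgI (pnat_dvd (dvdn_indexg _ _)).
exists (K :&: P)%G; split=> // a Za a_pr xa y K0y.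
have [sZV cVZ] := subsetIP (subxx 'Z(V)).
set W := 'Z(V)%G; pose K0 := (K :&: P)%G.
have sWV : W \subset V by [].
have sWK : W \subset K := subset_trans sWV sVK.
have tiPW : P :&: W = 1 by apply/trivgP; rewrite -tiPV setIS.
have nsWG : W <| G := gFnormal_trans _ nsVG.
have nWP : P \subset 'N(W) := subset_trans sPG (normal_norm nsWG).
(* The commutator of g and h is in W, since P normalises W, and in P. *)
have commW g h : g \in P -> h \in W -> g ^ h \in P -> g ^ h = g.
  move=> Pg Wh Pgh; apply/conjg_fixP/eqP/set1gP; rewrite -tiPW inE.
  rewrite {1}/commg groupM ?groupV //= commgEr groupM ?memJ_norm ?groupV //.
  by rewrite (subsetP nWP).
have sylKa : (K0 :^ a)%G \in 'Syl_p(K) by rewrite inE pHallJ // (subsetP sWK).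
have cT := permK p _ p_pr sylKa.
have pT : p.-group (<[x]> <*> (K0 :^ a)).
  rewrite comm_joingE // pgroupM [p.-group _]px pgroupJ.
  by rewrite (pgroupS (subsetIr K P)).
have sTWP : <[x]> <*> (K0 :^ a) \subset W <*> P.
  rewrite join_subG (subset_trans sxP) ?joing_subr // conj_subG //.
    by rewrite (subsetP (joing_subl W P)).
  by rewrite (subset_trans (subsetIr K P)) ?joing_subr.
have sylWP : p.-Sylow(W <*> P) P.
  by rewrite (pHall_subl _ _ sylP) ?joing_subr // join_subG normal_sub.
(* The p-group generated by <[x]> and K0 :^ a is conjugate into P by some w in
   W. Then w centralises x and a * w centralises K0. *)
have [g WPg sTgP] := Sylow_Jsub sylWP sTWP pT.
move: WPg sTgP; rewrite /= norm_joinEr // => /mulsgP[w u Ww Pu ->].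
rewrite conjsgM sub_conjg conjGid ?groupV // => sTwP.
have Pxw : x ^ w \in P.
  apply: (subsetP sTwP); rewrite memJ_conjg.
  by rewrite (subsetP (joing_subl _ _)) ?cycle_id.
have Pyaw : y ^ (a * w) \in P.
  apply: (subsetP sTwP); rewrite conjgM memJ_conjg.
  by rewrite (subsetP (joing_subr _ _)) // memJ_conjg.
have xw := commW x w Px Ww Pxw.
have [Ky Py] := setIP K0y.
have Waw : a * w \in W by rewrite groupM.
have yaw := commW y (a * w) Py Waw Pyaw.
set q := #[a] in a_pr *.
have cW c d : c \in W -> d \in W -> commute c d.
  by move=> Wc Wd; apply: (centP (subsetP cVZ c Wc)); apply: (subsetP sWV).
have defa : a = (a * w).`_q * w^-1.`_q.
  rewrite -consttM; last by apply: cW; rewrite ?groupV.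
  by rewrite mulgK constt_p_elt // /p_elt pnat_id.
(* If the second factor is trivial, a is a power of a * w. Otherwise x fixes an
   element c of order q, which forces it to fix a. *)
have [b1 | ntb] := eqVneq w^-1.`_q 1.
  rewrite defa b1 mulg1; have /cycleP[m ->] := cycle_constt q (a * w).
  apply/conjg_fixP/commgP/commute_sym/commuteX.
  by apply/commgP/conjg_fixP.
case/eqP: xa.
have [] := pgroup_pdiv (p_elt_constt q w^-1); first by rewrite cycle_eq1.
move=> _ q_dv _; have [c bc oc] := Cauchy a_pr q_dv.
have wc : c \in <[w]>.
  apply: subsetP bc; rewrite cycle_subG.
  by rewrite (subsetP _ _ (cycle_constt q w^-1)) // cycle_subG groupV cycle_id.
have Wc : c \in W by apply: subsetP wc; rewrite cycle_subG.
have cx : c ^ x = c.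
  case/cycleP: wc => m ->; apply/conjg_fixP/commgP/commute_sym/commuteX.
  by apply/commgP/conjg_fixP.
have cac := cW a c Za Wc.
have xN d : d \in W -> d ^+ q = 1 -> x \in 'N(<[d]>).
  move=> Wd dq1; apply: (subsetP (@norm_cycle_p'core q d a_pr _ _)) => //.
    by apply: pnat_dvd (pnat_id a_pr); rewrite order_dvdn dq1.
  exact: (subsetP sWV).
apply: (conj_fix_mul_norm a_pr _ oc cac) => //; apply: xN.
- exact: Za.
- exact: expg_order.
- exact: groupM.
by rewrite expgMn // expg_order mul1g -oc expg_order.
Qed.

(** If y in K0 moved some element of V, it would fix some a moved by x and move
    some b fixed by x. Then x * y moves both, so that the subgroup K1 obtained
    from it as K0 is from x fixes both. Writing x = k * (x * y) ^+ i with k in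
    K1, x and x ^+ i agree on a, while y ^+ i fixes b; the latter makes p divide
    i, which contradicts the former. *)
Lemma supplement_cent_p'core x :
  x \in P -> x \notin 'C(V) -> P \subset <[x]> * 'C_P(V).
Proof.
move=> Px not_cVx; have [K0 [defP cK0]] := pelt_supplement Px.
rewrite -{1}defP mulgS // subsetI -{1}defP mulG_subr /=.
apply/subsetP=> y K0y; apply: contraT => not_cVy.
have Py : y \in P by rewrite -defP (subsetP (mulG_subr _ _)).
have [a Za [a_pr xa]] := moved_prime_center Px not_cVx.
have [b Zb [b_pr yb]] := moved_prime_center Py not_cVy.
have ya : a ^ y = a := cK0 a Za a_pr xa y K0y.
have xb : b ^ x = b.
  by apply/eqP; apply: contraNT yb => xb; rewrite (cK0 b Zb b_pr xb).
have Pxy : x * y \in P by rewrite groupM.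
have sZV : 'Z(V) \subset V := subsetIl _ _.
have PN g c : g \in P -> c \in 'Z(V) -> prime #[c] -> g \in 'N(<[c]>).
  move=> Pg Zc c_pr; apply: (subsetP (norm_cycle_p'core c_pr _ _)) => //.
    by rewrite /p_elt pnat_id.
  exact: subsetP sZV c Zc.
have axy : a ^ (x * y) = a ^ x.
  have /cycleP[m ax] : a ^ x \in <[a]>.
    by rewrite memJ_norm ?cycle_id // PN.
  by rewrite conjgM ax conjXg ya.
have bxy : b ^ (x * y) = b ^ y by rewrite conjgM xb.
have [K1 [defP1 cK1]] := pelt_supplement Pxy.
have : x \in K1 * <[x * y]> by rewrite (mulg_groupC defP1).
case/mulsgP=> k _ K1k /cycleP[i ->] defx.
have axi : a ^ x = a ^ (x ^+ i).
  rewrite {1}defx conjgM (cK1 a _ _ _ k) ?axy //.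
  by apply: conjg_expg_eq axy; apply: PN.
have byi : b ^ (y ^+ i) = b.
  rewrite -{2}xb defx conjgM (cK1 b _ _ _ k) ?bxy //.
  by apply/esym/conjg_expg_eq; rewrite ?PN.
have p_i : p %| i.
  apply: contraNT yb => p'i; apply/eqP.
  exact: conjg_fix_expg p_pr (mem_p_elt pP Py) p'i byi.
case: i p_i axi {defx byi} => [_ ax | j p_j1].
  by rewrite ax conjg1 eqxx in xa.
rewrite expgSr conjgM => /conjg_inj/esym axj.
case/eqP: xa; apply: conjg_fix_expg p_pr (mem_p_elt pP Px) _ axj.
by apply: contraL p_j1 => p_j; rewrite -addn1 dvdn_addr // gtnNdvd ?prime_gt1.
Qed.

(** V * C_P(V) * O_p(G) contains F(G), so it is normal, and it is nilpotent. *)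
Lemma cent_p'core_sub : 'C_P(V) \subset 'O_p(G).
Proof.
have sOP : 'O_p(G) \subset P := pcore_sub_Hall sylP.
set Y := 'C_P(V) <*> 'O_p(G).
have sYP : Y \subset P by rewrite join_subG subsetIl.
have /dprodP[_ defF cOV _] := nilpotent_pcoreC p (Fitting_nil G).
rewrite p_core_Fitting -/V in defF cOV.
have cVY : Y \subset 'C(V) by rewrite join_subG subsetIr centsC.
have nilVY : nilpotent (V <*> Y).
  rewrite /= cent_joinEr // mulg_nil // nilV.
  exact: pgroup_nil (pgroupS sYP pP).
have sFVY : 'F(G) \subset V <*> Y.
  rewrite -defF mul_subG ?joing_subl //.
  exact: subset_trans (joing_subr _ _) (joing_subr V Y).
have sVYG : V <*> Y \subset G.
  by rewrite join_subG normal_sub // (subset_trans sYP).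
have nsVYG : V <*> Y <| G.
  by rewrite sub_der1_normal // (subset_trans sub_der1_Fitting).
have sCF : 'C_P(V) \subset 'F(G).
  apply: subset_trans (Fitting_max nsVYG nilVY).
  exact: subset_trans (joing_subl _ _) (joing_subr V Y).
have hallF := nilpotent_pcore_Hall p (Fitting_nil G).
rewrite -p_core_Fitting (sub_normal_Hall hallF) //.
  exact: pgroupS (subsetIl _ _) pP.
exact: pcore_normal.
Qed.

Lemma Sylow_sub_cycle_pcore x :
  x \in P -> x \notin 'O_p(G) -> P \subset <[x]> * 'O_p(G).
Proof.
move=> Px not_Ox; apply: subset_trans (supplement_cent_p'core Px _) _.
  by apply: contra not_Ox => cVx; rewrite (subsetP cent_p'core_sub) // inE Px.
by rewrite mulgS ?cent_p'core_sub.
Qed.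

End OnePrime.

Lemma cyclic_NSS_permutable H : H \subset G -> NSS_permutable H G.
Proof.
move=> sHG; split=> //.
pose pi := [pred p : nat | [forall x in H, p.-elt x ==> (x \in 'O_p(G))]].
have nsFG := Fitting_normal G; have [sFG nFG] := andP nsFG.
have nilGF : nilpotent (G / 'F(G)).
  by rewrite abelian_nil ?sub_der1_abelian ?sub_der1_Fitting.
have hallO := nilpotent_pcore_Hall pi nilGF.
have [K defK sFK nsKG] := inv_quotientN nsFG (pcore_normal pi (G / 'F(G))).
have [sKG nKG] := andP nsKG.
have memK (p : nat) g : g \in G -> p.-elt g -> p \in pi -> g \in K.
  move=> Gg pg pi_p; rewrite -cycle_subG.
  have nFg : <[g]> \subset 'N('F(G)) by rewrite cycle_subG (subsetP nFG).
  rewrite -(quotientSGK nFg sFK) -defK.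
  rewrite (sub_Hall_pcore hallO) ?quotientS ?cycle_subG //.
  by apply: quotient_pgroup; apply: sub_p_elt pg => r /eqnP->.
exists K; split=> //.
  (* For p outside pi, some p-element of H is not in O_p(G); together with
     O_p(G) it generates a Sylow p-subgroup of G. *)
  have sFHK : 'F(G) \subset H <*> K := subset_trans sFK (joing_subr H K).
  have nsHKG : H <*> K <| G.
    rewrite sub_der1_normal ?(subset_trans sub_der1_Fitting) //.
    by rewrite join_subG sHG.
  rewrite -norm_joinEl ?(subset_trans sHG) //.
  apply/eqP; rewrite eqEsubset (normal_sub nsHKG).
  apply: subset_pelt => p g p_pr Gg pg.
  have [pi_p | ] := boolP (p \in pi).
    by rewrite (subsetP (joing_subr H K)) // (memK p).
  rewrite inE negb_forall_in => /exists_inP[x Hx]; rewrite negb_imply.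
  case/andP=> px notOx.
  have sxG : <[x]> \subset G by rewrite cycle_subG (subsetP sHG).
  have sgG : <[g]> \subset G by rewrite cycle_subG.
  have [P sylP] := Sylow_superset sxG px; rewrite cycle_subG => Px.
  have [t Gt] := Sylow_Jsub sylP sgG pg.
  rewrite -cycleJ cycle_subG => Pgt.
  rewrite -(memJ_norm _ (subsetP (normal_norm nsHKG) t Gt)).
  have sPxO := Sylow_sub_cycle_pcore p_pr sylP Px notOx.
  apply: subsetP Pgt; apply: subset_trans sPxO _.
  rewrite mul_subG ?cycle_subG ?(subsetP (joing_subl H K)) //.
  by rewrite (subset_trans _ sFHK) // -p_core_Fitting pcore_sub.
move=> p P p_pr; rewrite inE => sylP.
have [sPK pP] := (pHall_sub sylP, pHall_pgroup sylP).
have [pi_p | pi'p] := boolP (p \in pi); last first.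
  (* P / F(G) is both a p-group and a pi-group. *)
  have sPF : P \subset 'F(G).
    have nFP := subset_trans sPK (subset_trans sKG nFG).
    rewrite -quotient_sub1 //; apply/trivgP/card1_trivg; apply: (@pnat_1 pi).
      apply: pgroupS (pcore_pgroup pi (G / 'F(G))).
      by rewrite defK quotientS.
    apply: sub_in_pnat (quotient_pgroup _ pP) => r _ /eqnP->.
    exact: pi'p.
  have -> : P :=: 'O_p(G).
    rewrite -p_core_Fitting; apply: nilpotent_Hall_pcore (Fitting_nil G) _.
    exact: pHall_subl sPF sFK sylP.
  by apply/normC/(subset_trans sHG)/gFnorm.
(* For p in pi, K contains all the p-elements of G. *)
have sylGP : p.-Sylow(G) P.
  have [P1 sylP1 sPP1] := Sylow_superset (subset_trans sPK sKG) pP.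
  suff -> : P = P1 by [].
  apply/esym/group_inj/(sub_pHall sylP); rewrite ?(pHall_pgroup sylP1) //.
  apply/subsetP=> g P1g; apply: (memK p) pi_p.
    exact: subsetP (pHall_sub sylP1) g P1g.
  exact: mem_p_elt (pHall_pgroup sylP1) P1g.
apply: pelt_permute_permute => q x q_pr Hx qx.
have [eq_pq | neq_pq] := eqVneq p q; last first.
  exact: pelt_permutes_Sylow (subsetP sHG x Hx) qx p_pr sylGP neq_pq.
have Px : <[x]> \subset P.
  rewrite cycle_subG (subsetP (pcore_sub_Hall sylGP)) //.
  move: pi_p; rewrite inE => /forall_inP/(_ x Hx)/implyP; apply.
  by rewrite eq_pq.
by rewrite mulSGid // mulGSid.
Qed.

End CyclicPermutable.

Theorem theorem1p7 (gT : finGroupType) (G : {group gT}) (solG : solvable G) :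
  [<-> SST_group G;
       NSST_group G;
       forall H : {group gT}, H \subset G -> SS_permutable H G;
       forall H : {group gT}, H \subset G -> NSS_permutable H G;
       forall H : {group gT}, H \subset G -> p_group H -> SS_permutable H G;
       forall H : {group gT}, H \subset G -> p_group H -> NSS_permutable H G;
       forall H : {group gT}, H \subset G -> cyclic H -> p_group H ->
         SS_permutable H G;
       forall H : {group gT}, H \subset G -> cyclic H -> p_group H ->
         NSS_permutable H G].
Proof.
have all_of_cyclic := cyclic_NSS_permutable solG.
have NSS_SS := @NSS_permutable_SS gT.
tfae.
- move=> sst H K sHK sKG _ _; apply: all_of_cyclic (subset_trans sHK sKG).
  by move=> L sLG _ pL; apply: (transitive_pgroup solG NSS_SS _ sst).
- move=> nsst H sHG; apply/NSS_SS/all_of_cyclic => // L sLG _ pL.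
  exact/NSS_SS/(transitive_pgroup solG _ NSS_SS nsst).
- by move=> allSS; apply: all_of_cyclic => L sLG _ _; apply: allSS.
- by move=> allNSS H sHG _; apply/NSS_SS/allNSS.
- move=> pSS H sHG _; apply: all_of_cyclic => // L sLG _; exact: pSS.
- by move=> pNSS H sHG _ pH; apply/NSS_SS/pNSS.
- by move=> cSS H sHG _ _; apply: all_of_cyclic.
move=> cNSS H K sHK sKG _ _; apply/NSS_SS/all_of_cyclic.
  by move=> L sLG cL pL; apply/NSS_SS/cNSS.
exact: subset_trans sHK sKG.
Qed.
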